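(* Let $r\ge 3$ and $k\ge 0$ be integers, let $G$ be a $(K_{1,r};k)$-vertex stable graph of order $r+k+1$, and let $k_0=\min\{k' : k'>(r-1)^2-2 \text{ and } k' \text{ is odd}\}$. (1) If $r$ is odd, or $r$ is even and $k<(r-1)^2-2$, then $|E(G)|\ge \frac12(k+1)(2r+k)$, and the sole extremal graph is $G(r,k)$. (2) If $r$ is even and $k=(r-1)^2-2$, then $|E(G)|\ge \frac12(k+1)(2r+k)$ and there are exactly two extremal graphs: $G(r,k)$ and $K_{r+k+1}^{r+k-1}$. If $r$ is even and $k=(r-1)^2-1$, then $|E(G)|\ge \frac12(k+1)(2r+k)$ and there are exactly two extremal graphs: $G(r,k)$ and $K_{r+k}^{r+k-2}*K_1$. (3) If $r$ is even, $k$ is odd and $k\ge k_0$, then $|E(G)|\ge \frac12((r+k)^2-1)$ and the sole extremal graph is $K_{r+k+1}^{r+k-1}$. (4) If $r$ and $k$ are both even and $k\ge k_0$, then $|E(G)|\ge \frac12(r+k)^2$ and the sole extremal graph is $K_{r+k}^{r+k-2}*K_1$.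
   Context: Graphs are finite, undirected, simple. A graph $G$ is $(H;k)$-vertex stable if for every set $F$ of $k$ vertices of $G$, the graph $G-F$ (obtained by deleting the vertices of $F$ with their incident edges) contains a subgraph isomorphic to $H$. $K_{1,r}$ is the star with one center and $r\ge 3$ leaves. An extremal graph (in each case) means a $(K_{1,r};k)$-vertex stable graph of order $r+k+1$ whose number of edges equals the stated lower bound; ''sole''/''exactly two'' is up to isomorphism. $G(r,k)$ denotes $K_{k+1}*\overline{K}_r$: a clique on $k+1$ vertices, an independent set of $r$ vertices, and all edges between the two sets. For graphs $G_1,G_2$ on disjoint vertex sets, $G_1*G_2$ has vertex set $V(G_1)\cup V(G_2)$ and edge set $E(G_1)\cup E(G_2)$ plus all edges between $V(G_1)$ and $V(G_2)$. For even $n$, $K_n^{n-2}$ is the $(n-2)$-regular graph of order $n$ (complete graph $K_n$ minus a perfect matching). $K_{r+k}^{r+k-2}*K_1$ is thus $K_{r+k}^{r+k-2}$ with one additional vertex adjacent to all other vertices. *)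

(* Defs.v *)
From HB Require Import structures.
From mathcomp Require Import all_boot all_order all_algebra.
From mathcomp Require Import zify.

Set Implicit Arguments.
Unset Strict Implicit.
Unset Printing Implicit Defensive.

Record sgraph := SGraph {
  vertex :> finType;
  adj : rel vertex;
  adj_sym : symmetric adj;
  adj_irr : irreflexive adj
}.

Definition edges (G : sgraph) : {set {set G}} :=
  [set e : {set G} | [exists x : G, exists y : G,
                        adj x y && (e == [set x; y])]].

Definition isomorphic (G H : sgraph) : Prop :=
  exists f : G -> H, bijective f /\ forall x y, adj (f x) (f y) = adj x y.

Section Subgraphs.
Variable G : sgraph.

Record subgraph := Subgraph {
  sub_vertices : {set G};
  sub_adj : rel G;
  sub_adj_sym : symmetric sub_adj;
  sub_adj_vertices : forall x y,
    sub_adj x y -> (x \in sub_vertices) && (y \in sub_vertices);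
  sub_adj_adj : forall x y, sub_adj x y -> adj x y
}.

Section AsGraph.
Variable S : subgraph.
Let V := {x : G | x \in sub_vertices S}.
Let e : rel V := fun x y => sub_adj S (val x) (val y).

Fact subgraph_sym : symmetric e.
Proof. by move=> x y; rewrite /e sub_adj_sym. Qed.

Fact subgraph_irr : irreflexive e.
Proof. by move=> x; apply/negP => /sub_adj_adj; rewrite adj_irr. Qed.

Definition graph_of_subgraph : sgraph := SGraph subgraph_sym subgraph_irr.
End AsGraph.

Section DeleteVertices.
Variable F : {set G}.
Let V := {x : G | x \notin F}.
Let e : rel V := fun x y => adj (val x) (val y).

Fact delete_vertices_sym : symmetric e.
Proof. by move=> x y; rewrite /e adj_sym. Qed.

Fact delete_vertices_irr : irreflexive e.
Proof. by move=> x; rewrite /e adj_irr. Qed.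

Definition delete_vertices : sgraph :=
  SGraph delete_vertices_sym delete_vertices_irr.
End DeleteVertices.

End Subgraphs.

Definition contains_copy (G H : sgraph) : Prop :=
  exists S : subgraph G, isomorphic (graph_of_subgraph S) H.

Definition vertex_stable (H : sgraph) (k : nat) (G : sgraph) : Prop :=
  forall F : {set G}, #|F| = k -> contains_copy (delete_vertices F) H.

Section Complete.
Variable n : nat.
Let e : rel 'I_n := fun x y => x != y.

Fact complete_sym : symmetric e.
Proof. by move=> x y; rewrite /e eq_sym. Qed.

Fact complete_irr : irreflexive e.
Proof. by move=> x; rewrite /e eqxx. Qed.

Definition complete : sgraph := SGraph complete_sym complete_irr.
End Complete.

Section Edgeless.
Variable n : nat.
Let e : rel 'I_n := fun _ _ => false.

Fact edgeless_sym : symmetric e. Proof. by []. Qed.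
Fact edgeless_irr : irreflexive e. Proof. by []. Qed.

Definition edgeless : sgraph := SGraph edgeless_sym edgeless_irr.
End Edgeless.

Section CompleteMinusMatching.
Variable n : nat.
Let e : rel 'I_n := fun x y => x./2 != y./2.

Fact complete_minus_matching_sym : symmetric e.
Proof. by move=> x y; rewrite /e eq_sym. Qed.

Fact complete_minus_matching_irr : irreflexive e.
Proof. by move=> x; rewrite /e eqxx. Qed.

(* The removed matching is {0, 1}, {2, 3}, ... It is perfect, and the graph is *)
(* K_n^{n-2}, only for even n; for odd n the vertex n - 1 stays unmatched.     *)
Definition complete_minus_matching : sgraph :=
  SGraph complete_minus_matching_sym complete_minus_matching_irr.
End CompleteMinusMatching.

Section Join.
Variables G1 G2 : sgraph.
Let e : rel (G1 + G2)%type := fun u v =>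
  match u, v with
  | inl x, inl y => adj x y
  | inr x, inr y => adj x y
  | _, _ => true
  end.

Fact join_sym : symmetric e.
Proof. by case=> x [] y //=; apply: adj_sym. Qed.

Fact join_irr : irreflexive e.
Proof. by case=> x /=; apply: adj_irr. Qed.

Definition join : sgraph := SGraph join_sym join_irr.
End Join.

Definition star (r : nat) : sgraph := join (complete 1) (edgeless r).

Definition Grk (r k : nat) : sgraph := join (complete k.+1) (edgeless r).

Definition star_stable_graph (r k : nat) (G : sgraph) : Prop :=
  vertex_stable (star r) k G /\ #|G| = r + k + 1.

Definition edge_lower_bound (r k : nat) (b : rat) : Prop :=
  forall G : sgraph, star_stable_graph r k G -> (b <= #|edges G|%:R)%R.

Definition extremal (r k : nat) (b : rat) (G : sgraph) : Prop :=
  star_stable_graph r k G /\ (#|edges G|%:R = b)%R.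

Definition sole (P : sgraph -> Prop) (H : sgraph) : Prop :=
  P H /\ forall G, P G -> isomorphic G H.

Definition exactly_two (P : sgraph -> Prop) (H1 H2 : sgraph) : Prop :=
  [/\ P H1, P H2, ~ isomorphic H1 H2
    & forall G, P G -> isomorphic G H1 \/ isomorphic G H2].

(* Subtraction on nat truncates; (r - 1) ^ 2 - 2 is exact as soon as 3 <= r. *)
Fact k0_exists (r : nat) : exists k' : nat, ((r - 1) ^ 2 - 2 < k') && odd k'.
Proof. by exists ((r - 1) ^ 2).*2.+1; apply/andP; split; lia. Qed.

Definition k0 (r : nat) : nat := ex_minn (k0_exists r).

(* Main.v *)
(* Pass to the complement of G, on n = r + k + 1 vertices: G is stable iff
   every set of r + 1 vertices contains a vertex that is isolated in the
   complement induced on this set, and the number of edges of the complement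
   is to be maximised. Let D be the set of non-isolated vertices of the
   complement. If #|D| <= r, there are at most r(r-1)/2 edges, with equality
   only for a clique on r vertices, that is, for G(r,k). If #|D| > r, then the
   complement is a matching and r is even: a vertex of degree at least 2
   produces subgraphs without isolated vertices of every order from 3 to #|D|,
   and a matching produces every even order up to #|D|. A matching has at most
   n./2 edges, and the cases of the theorem compare r(r-1)/2 with n./2. *)

Require Import Defs.
From HB Require Import structures.
From mathcomp Require Import all_boot all_order all_algebra.
From mathcomp Require Import zify lra.

Set Implicit Arguments.
Unset Strict Implicit.
Unset Printing Implicit Defensive.

Import Order.TTheory GRing.Theory Num.Theory.

(** * Vertex sets without isolated vertices, in a symmetric irreflexive relation *)

Section Relation.
Variables (T : finType) (e : rel T).
Hypotheses (e_sym : symmetric e) (e_irr : irreflexive e).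

Definition isolated_free (S : {set T}) : bool :=
  [forall (x | x \in S), [exists (y | y \in S), e x y]].

Definition nonisolated : {set T} := [set x | [exists y, e x y]].

Definition matching : bool :=
  [forall x, forall y, forall z, e x y ==> e x z ==> (y == z)].

Lemma isolated_freeP (S : {set T}) :
  reflect (forall x, x \in S -> exists2 y, y \in S & e x y) (isolated_free S).
Proof. by apply: (iffP forall_inP) => H x /H /exists_inP. Qed.

Lemma nonisolatedP x : reflect (exists y, e x y) (x \in nonisolated).
Proof. by rewrite inE; apply: existsP. Qed.

Lemma matchingP :
  reflect (forall x y z, e x y -> e x z -> y = z) matching.
Proof.
apply: (iffP forallP) => [H x y z xy xz|H x].
  by have /forallP/(_ y)/forallP/(_ z) := H x; rewrite xy xz => /eqP.
by apply/forallP=> y; apply/forallP=> z; apply/implyP=> xy; apply/implyP=> xz;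
  apply/eqP; apply: H xy xz.
Qed.

Lemma isolated_freeU (S1 S2 : {set T}) :
  isolated_free S1 -> isolated_free S2 -> isolated_free (S1 :|: S2).
Proof.
move=> /isolated_freeP f1 /isolated_freeP f2; apply/isolated_freeP=> x.
by rewrite inE => /orP[/f1|/f2] [y yS xy]; exists y => //; rewrite inE yS ?orbT.
Qed.

Lemma isolated_free_edge x y : e x y -> isolated_free [set x; y].
Proof.
move=> xy; apply/isolated_freeP=> z; rewrite !inE => /orP[]/eqP->.
  by exists y; rewrite // !inE eqxx orbT.
by exists x; rewrite ?inE ?eqxx // e_sym.
Qed.

Lemma isolated_freeU1 (S : {set T}) x y :
  isolated_free S -> y \in S -> e x y -> isolated_free (x |: S).
Proof.
move=> fS yS xy; have -> : x |: S = [set x; y] :|: S.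
  by apply/setP=> z; rewrite !inE; case: eqVneq => //= _; case: eqVneq => // ->.
exact: isolated_freeU (isolated_free_edge xy) fS.
Qed.

(* Adding an edge disjoint from the current set raises its size by 2; the
   removable vertex v makes up for the size that was skipped. *)
Definition free_extension t := exists (W : {set T}) (v : T),
  [/\ #|W| = t, v \notin W, isolated_free W & isolated_free (v |: W)].

(** A non-isolated [x] outside [v |: W] has a neighbour [y]. If [y] lies in [v |: W], then [x] can
    be added and becomes the new removable vertex. Otherwise the whole edge joins [W], and [v] stays
    removable. *)
Lemma free_extensionS t : t.+1 < #|nonisolated| ->
  free_extension t -> free_extension t.+1 \/ free_extension t.+2.
Proof.
move=> tD [W [v [cW vW fW fvW]]].
have cU : #|v |: W| = t.+1 by rewrite cardsU1 vW cW.
have [x xD xU] : exists2 x, x \in nonisolated & x \notin v |: W.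
  by apply/subsetPn; apply: contraL tD => /subset_leq_card; rewrite cU -leqNgt.
have [y xy] := nonisolatedP _ xD.
have [yU|yU] := boolP (y \in v |: W).
  by left; exists (v |: W), x; split=> //; apply: isolated_freeU1 fvW yU xy.
right; exists (W :|: [set x; y]), v.
move: xU yU; rewrite !inE !negb_or => /andP[xv xW] /andP[yv yW].
split.
- have d : W :&: [set x; y] = set0.
    apply/setP=> z; rewrite in_set0; apply/negbTE.
    rewrite !inE; apply/negP=> /andP[zW].
    by case/orP=> /eqP E; move: zW; rewrite E ?(negPf xW) ?(negPf yW).
  rewrite cardsU d cards0 subn0 cW cards2.
  by case: eqVneq xy => [->|]; rewrite ?e_irr // addn2.
- by rewrite vW ![v == _]eq_sym xv yv.
- exact: isolated_freeU (isolated_free_edge xy).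
- by rewrite setUA; apply: isolated_freeU (isolated_free_edge xy).
Qed.

(** The induction starts from a path on three vertices, which exists as soon as some vertex has two
    neighbours. One of its ends is the removable vertex. *)
Lemma exists_isolated_free s : ~~ matching -> 2 < s <= #|nonisolated| ->
  exists2 S : {set T}, #|S| = s & isolated_free S.
Proof.
move=> nM /andP[s2 sD].
have [b [a [c [ba bc ac]]]] : exists b a c, [/\ e b a, e b c & a != c].
  move: nM; rewrite negb_forall => /existsP[b].
  rewrite negb_forall => /existsP[a]; rewrite negb_forall => /existsP[c].
  by rewrite !negb_imply => /and3P[? ? ?]; exists b, a, c.
have base : free_extension 2.
  exists [set a; b], c.
  have ab : e a b by rewrite e_sym.
  have cb : e c b by rewrite e_sym.
  split.
  - by rewrite cards2; case: eqVneq ab => // ->; rewrite e_irr.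
  - rewrite !inE negb_or eq_sym ac.
    by case: eqVneq cb => // ->; rewrite e_irr.
  - exact: isolated_free_edge.
  - apply: isolated_freeU1 (isolated_free_edge ab) _ cb.
    by rewrite !inE eqxx orbT.
(* A size may be skipped, but never two consecutive ones. Size [s] is then reached by [W] itself, or
   by [v |: W] when [W] has one vertex less. *)
have step j : j.+2 < #|nonisolated| -> free_extension j.+2 \/ free_extension j.+3.
  elim: j => [|j IH] jD; first by left.
  have [/free_extensionS ext|] := IH (ltnW jD); last by left.
  exact: ext.
case: s s2 sD => [|[|[|s]]] // _ sD.
have [] := step _ sD => -[W [v [cW vW fW fvW]]].
  by exists (v |: W); rewrite // cardsU1 vW cW.
by exists W.
Qed.

(** Partners are listed next to each other, so they are the positions with equal halves, as in
    [complete_minus_matching]. Closure of the list under partners carries the induction: a new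
    vertex brings a partner that is new as well. *)
Lemma matching_enumeration j : matching -> j.*2 <= #|nonisolated| ->
  exists s : seq T, [/\ uniq s, size s = j.*2,
    forall x y, x \in s -> e x y -> y \in s &
    forall x0 i i', i < j.*2 -> i' < j.*2 ->
      e (nth x0 s i) (nth x0 s i') = (i != i') && (i./2 == i'./2)].
Proof.
move=> /matchingP M; elim: j => [|j IH] jD.
  by exists [::].
have [s [us ss cs es]] := IH ltac:(lia).
have [x xD xs] : exists2 x, x \in nonisolated & x \notin s.
  have /subsetPn[x xD] : ~~ (nonisolated \subset s).
    apply: contraL jD => /subset_leq_card /leq_trans/(_ (card_size s)).
    by rewrite ss -ltnNge; lia.
  by exists x.
have [y xy] := nonisolatedP _ xD.
have yx : e y x by rewrite e_sym.
have ys : y \notin s by apply: contra xs => /cs/(_ yx).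
have xNy : x != y by case: eqVneq xy => // ->; rewrite e_irr.
have xF z : z \in s -> e x z = false.
  by move=> zs; apply/negP=> /(M _ _ _ xy) E; move: ys; rewrite E zs.
have yF z : z \in s -> e y z = false.
  by move=> zs; apply/negP=> /(M _ _ _ yx) E; move: xs; rewrite E zs.
exists [:: x, y & s]; split.
- by rewrite /= us inE negb_or xNy xs ys.
- by rewrite /= ss doubleS.
- move=> u v; rewrite !inE => /or3P[/eqP-> xv|/eqP-> yv|us' uv].
  + by rewrite (M _ _ _ xv xy) eqxx orbT.
  + by rewrite (M _ _ _ yv yx) eqxx.
  + by rewrite (cs _ _ us' uv) !orbT.
- have ns x0 i : i < j.*2 -> nth x0 s i \in s by move=> ?; rewrite mem_nth ?ss.
  move=> x0 [|[|i]] [|[|i']] //=;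
    rewrite ?e_irr ?xy ?yx // ?doubleS ?ltnS => li li'.
  + by rewrite xF ?ns.
  + by rewrite yF ?ns.
  + by rewrite e_sym xF ?ns.
  + by rewrite e_sym yF ?ns.
  + by rewrite es.
Qed.

(** In such a set every vertex has its unique partner in the set, so removing a vertex with its
    partner leaves a smaller set of the same kind. *)
Lemma matching_isolated_free_even (S : {set T}) :
  matching -> isolated_free S -> ~~ odd #|S|.
Proof.
move=> /matchingP M; move: {2}#|S| (leqnn #|S|) => n.
elim: n S => [|n IH] S cS /isolated_freeP fS.
  by move: cS; rewrite leqn0 => /eqP->.
have [->|[x xS]] := set_0Vmem S; first by rewrite cards0.
have [y yS xy] := fS x xS; have yx : e y x by rewrite e_sym.
have xNy : x != y by case: eqVneq xy => // ->; rewrite e_irr.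
have yS' : y \in S :\ x by rewrite !inE eq_sym xNy.
have cE : #|S| = #|S :\ x :\ y|.+2 by rewrite (cardsD1 x) xS (cardsD1 y) yS'.
rewrite cE /= negbK; apply: IH; first by lia.
apply/isolated_freeP=> z; rewrite !inE => /and3P[zy zx zS].
have [w wS zw] := fS z zS; exists w => //; rewrite !inE wS andbT.
have wz : e w z by rewrite e_sym.
apply/andP; split.
  by apply: contraNneq zx => E; rewrite E in wz; rewrite (M _ _ _ wz yx).
by apply: contraNneq zy => E; rewrite E in wz; rewrite (M _ _ _ wz xy).
Qed.

Lemma matching_sum_deg : matching -> \sum_x #|e x| = #|nonisolated|.
Proof.
move=> /matchingP M; rewrite -sum1_card [RHS]big_mkcond; apply: eq_bigr => x _.
case: nonisolatedP => [[y xy]|nx].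
  rewrite (eq_card (B := pred1 y)) ?card1 // => z; rewrite !inE /in_mem /=.
  by apply/idP/eqP => [/M/(_ xy)|->].
by apply: eq_card0 => z; apply/negP=> xz; apply: nx; exists z.
Qed.

(** All neighbours of a non-isolated vertex are other non-isolated vertices. Equality means that
    these vertices form a clique. *)
Lemma sum_deg_leqif :
  \sum_x #|e x| <= #|nonisolated| * #|nonisolated|.-1
    ?= iff [forall (x | x \in nonisolated), nonisolated :\ x \subset e x].
Proof.
have -> : \sum_x #|e x| = \sum_(x in nonisolated) #|e x|.
  rewrite [RHS]big_mkcond; apply: eq_bigr => x _.
  case: ifP => // /nonisolatedP nx.
  by apply: eq_card0 => z; apply/negP=> xz; apply: nx; exists z.
have -> : #|nonisolated| * #|nonisolated|.-1
        = \sum_(x in nonisolated) #|nonisolated :\ x|.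
  rewrite -sum_nat_const; apply: eq_bigr => x xD.
  by rewrite [in LHS](cardsD1 x) xD.
apply: leqif_sum => x xD; apply: subset_leqif_card.
apply/subsetP=> y xy; rewrite !inE; apply/andP; split.
  by apply: contraTneq xy => ->; rewrite /in_mem /= e_irr.
by apply/existsP; exists x; rewrite e_sym.
Qed.

End Relation.

(** * Isomorphisms, bijections respecting a subset, and the handshake identity *)

Lemma isomorphic_sym (G H : sgraph) : isomorphic G H -> isomorphic H G.
Proof.
move=> [f [[g fK gK] fA]]; exists g; split; first by exists f.
by move=> x y; rewrite -fA !gK.
Qed.

Lemma isomorphic_trans (G H K : sgraph) :
  isomorphic G H -> isomorphic H K -> isomorphic G K.
Proof.
move=> [f [bf fA]] [g [bg gA]]; exists (g \o f); split; first exact: bij_comp.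
by move=> x y /=; rewrite gA fA.
Qed.

(** Enumerating [A] before its complement gives its members exactly the ranks below [#|A|].
    Composing two such rankings matches sets of equal size. *)
Lemma bij_rank (T : finType) (A : {set T}) :
  exists2 f : T -> 'I_#|T|, bijective f & forall x, (f x < #|A|)%N = (x \in A).
Proof.
pose s := enum A ++ enum (~: A).
have sP x : x \in s by rewrite mem_cat !mem_enum inE orbN.
have szs : size s = #|T| by rewrite size_cat -!cardE cardsC.
have sI x : (index x s < #|T|)%N by rewrite -szs index_mem.
exists (fun x => Ordinal (sI x)).
  apply: inj_card_bij; last by rewrite card_ord.
  by move=> x y /(congr1 val) /= /(congr1 (nth x s)); rewrite !nth_index.
move=> x /=; rewrite index_cat mem_enum; case: ifP => xA.
  by rewrite cardE index_mem mem_enum.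
by rewrite cardE ltnNge leq_addr.
Qed.

Lemma bij_of_card (T1 T2 : finType) (A : {set T1}) (B : {set T2}) :
  #|T1| = #|T2| -> #|A| = #|B| ->
  exists2 f : T1 -> T2, bijective f & forall x, (f x \in B) = (x \in A).
Proof.
move=> cT cAB.
have [f bf fA] := bij_rank A; have [g [g' gK g'K] gB] := bij_rank B.
exists (g' \o cast_ord cT \o f).
  apply: bij_comp bf; apply: bij_comp; first by exists g.
  by exists (cast_ord (esym cT)); [apply: cast_ordK | apply: cast_ordKV].
by move=> x; rewrite -gB /= g'K /= -cAB fA.
Qed.

(** Ordered adjacent pairs are counted twice: by first component, and by the edge they span. *)
Lemma card_edges (G : sgraph) : \sum_(x : G) #|adj x| = (2 * #|edges G|)%N.
Proof.
transitivity (\sum_(p : G * G | adj p.1 p.2) 1)%N.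
  rewrite -(pair_big_dep xpredT (fun x y : G => adj x y) (fun _ _ => 1%N)).
  by apply: eq_bigr => x _; rewrite sum1_card.
rewrite (partition_big (fun p => [set p.1; p.2]) (mem (edges G))) /=; last first.
  move=> [x y] /= xy; rewrite inE; apply/existsP; exists x.
  by apply/existsP; exists y; rewrite xy eqxx.
rewrite mulnC -sum_nat_const; apply: eq_bigr => d.
rewrite inE => /existsP[a /existsP[b /andP[ab /eqP->]]].
have aNb : a != b by case: eqVneq ab => // ->; rewrite adj_irr.
(* The pairs spanning the edge {a, b} are [(a, b)] and [(b, a)], distinct because the graph has no
   loops. *)
rewrite sum1_card -[RHS](_ : #|[set (a, b); (b, a)]| = _); last first.
  by rewrite cards2 xpair_eqE negb_and aNb.
apply: eq_card => -[x y]; rewrite !inE /in_mem /= !xpair_eqE.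
apply/andP/orP => [[xy /eqP E]|].
  have : x \in [set a; b] by rewrite -E !inE eqxx.
  have : y \in [set a; b] by rewrite -E !inE eqxx orbT.
  have xNy : x != y by case: eqVneq xy => // ->; rewrite adj_irr.
  rewrite !inE => /orP[]/eqP yE /orP[]/eqP xE; subst; rewrite ?eqxx ?orbT //;
  by rewrite ?eqxx in xNy; auto.
by case=> /andP[/eqP-> /eqP->]; rewrite ?ab ?eqxx // adj_sym ab setUC eqxx.
Qed.

(** * Stability expressed in the complement graph *)

Section Stability.
Variable G : sgraph.

(** The complement is kept as a relation on [G], so that the results on relations apply to it
    directly. *)
Definition coadj : rel G := fun x y => (x != y) && ~~ adj x y.

Lemma coadj_sym : symmetric coadj.
Proof. by move=> x y; rewrite /coadj eq_sym adj_sym. Qed.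

Lemma coadj_irr : irreflexive coadj.
Proof. by move=> x; rewrite /coadj eqxx. Qed.

Lemma adj_coadj x y : adj x y = (x != y) && ~~ coadj x y.
Proof. by rewrite /coadj; case: eqVneq => [->|]; rewrite ?adj_irr //= negbK. Qed.

Lemma sum_codegree :
  (2 * #|edges G| + \sum_x #|coadj x| = #|G| * #|G|.-1)%N.
Proof.
rewrite -card_edges -big_split /= -sum_nat_const; apply: eq_bigr => x _.
rewrite -(cardC1 x) -cardUI [X in (_ + X)%N]eq_card0 ?addn0.
  apply: eq_card => y; rewrite !inE /in_mem /= /coadj eq_sym.
  by case: eqVneq => [->|]; rewrite ?adj_irr //= orbN.
by move=> y; rewrite !inE /in_mem /= /coadj; case: adj; rewrite ?andbF.
Qed.

(** A copy of the star on [r.+1] vertices spans the graph, so only a vertex adjacent to all others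
    is needed as its centre. *)
Lemma contains_star r : #|G| = r.+1 ->
  contains_copy G (star r) <-> exists c : G, forall x, x != c -> adj c x.
Proof.
move=> cG; split.
  move=> [S [f [[g fK gK] fA]]].
  have sT : sub_vertices S = setT.
    apply/eqP; rewrite eqEcard subsetT cardsT cG.
    have : #|graph_of_subgraph S| = #|star r|.
      by apply: bij_eq_card (Bijective fK gK).
    rewrite card_sum !card_ord add1n => <-; rewrite card_sig.
    apply: subset_leq_card.
    by apply/subsetP=> x; rewrite !inE.
  have inS x : x \in sub_vertices S by rewrite sT inE.
  exists (val (g (inl ord0))) => x xc.
  pose x' : graph_of_subgraph S := exist _ x (inS x).
  apply: (@sub_adj_adj _ S); rewrite -[x]/(val x').
  rewrite -[sub_adj _ _ _]/(@adj (graph_of_subgraph S) _ x') -fA gK.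
  case E: (f x') => [i|i] //; case/eqP: xc.
  have -> : @ord0 0 = i by apply: val_inj; case: i {E} => -[].
  by rewrite -E fK.
move=> [c cP].
(* The subgraph keeps only the edges with exactly one end at [c]. Adjacency in the star has the same
   form, so any bijection sending [c] to the centre is an isomorphism. *)
pose e (x y : G) := (x == c) (+) (y == c).
have eS : symmetric e by move=> x y; rewrite /e addbC.
have eV x y : e x y -> (x \in [set: G]) && (y \in [set: G]) by rewrite !inE.
have eA x y : e x y -> adj x y.
  rewrite /e; case: eqVneq => [->|xc]; case: eqVneq => [->|yc] //= _.
    exact: cP.
  by rewrite adj_sym cP.
exists (Subgraph eS eV eA).
set H := graph_of_subgraph _.
have cT : c \in [set: G] by rewrite inE.
pose B : {set star r} := [set inl ord0].
have [f bf fB] : exists2 f : H -> star r,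
    bijective f & forall x, (f x \in B) = (x \in [set (exist _ c cT : H)]).
  apply: bij_of_card; last by rewrite !cards1.
  rewrite card_sum !card_ord card_sig add1n -cG.
  by apply: eq_card => x; rewrite !inE.
exists f; split=> // x y.
have sE u v : @adj (star r) u v = (u \in B) (+) (v \in B).
  rewrite !inE; case: u v => [i|i] [j|j] //=.
  - have -> : i = ord0 by apply: val_inj; case: i => -[].
    by have -> : j = ord0 by apply: val_inj; case: j => -[].
  - by have -> : i = ord0 by apply: val_inj; case: i => -[].
  - by have -> : j = ord0 by apply: val_inj; case: j => -[].
by rewrite sE !fB !inE -!val_eqE.
Qed.

End Stability.

(** Deleting [k] vertices leaves a set of [r.+1] vertices, and every such set arises this way. A
    star centre in it is a vertex isolated in the complement induced there. *)
Lemma vertex_stable_starP r k (G : sgraph) : #|G| = (r + k + 1)%N ->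
  vertex_stable (star r) k G <->
  forall S : {set G}, #|S| = r.+1 -> ~~ isolated_free (@coadj G) S.
Proof.
move=> cG.
have equiv (F : {set G}) : #|F| = k ->
    contains_copy (delete_vertices F) (star r) <->
    ~~ isolated_free (@coadj G) (~: F).
  move=> cF; have cD : #|delete_vertices F| = r.+1.
    rewrite card_sig; have := cardsC F; rewrite cF cG.
    by rewrite (eq_card (B := ~: F)) => [|x]; rewrite ?inE //; lia.
  split.
    move=> /(contains_star cD) [[c cF'] cP].
    apply/isolated_freeP => /(_ c); rewrite inE => /(_ cF')[y].
    rewrite inE => yF /andP[cy /negP]; apply.
    by apply: (cP (exist _ y yF)); rewrite -val_eqE /= eq_sym.
  rewrite negb_forall => /existsP[c]; rewrite negb_imply inE => /andP[cF'].
  move/exists_inP => nE; apply/(contains_star cD); exists (exist _ c cF').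
  move=> [x xF]; rewrite -val_eqE /= eq_sym => cx; rewrite /adj /=.
  apply/negPn/negP => ncx; apply: nE; exists x; rewrite ?inE //.
  by rewrite /coadj cx.
split=> H S cS; last first.
  by apply/equiv => //; apply: H; have := cardsC S; lia.
rewrite -[S]setCK; apply/equiv; first by have := cardsC S; lia.
by apply: H; have := cardsC S; lia.
Qed.

(** * Degree sum of the complement; complements that are cliques or matchings *)

Definition codegree_sum (G : sgraph) : nat := \sum_(x : G) #|@coadj G x|.

(** The complement is a clique on [D] with all other vertices isolated: the shape of G(r,k), where
    [D] is the independent part. *)
Definition co_clique_on (G : sgraph) (D : {set G}) :=
  forall x y : G, coadj x y = [&& x != y, x \in D & y \in D].

Definition right_part (G H : sgraph) : {set join G H} := [set inr y | y : H].

Lemma card_right_part (G H : sgraph) : #|right_part G H| = #|H|.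
Proof. by rewrite card_imset //; apply: inr_inj. Qed.

Lemma card_Grk r k : #|Grk r k| = (r + k + 1)%N.
Proof. by rewrite card_sum !card_ord; lia. Qed.

Lemma co_clique_Grk r k : co_clique_on (right_part (complete k.+1) (edgeless r)).
Proof.
have inB (u : Grk r k) : (u \in right_part (complete k.+1) (edgeless r)) =
    if u is inr _ then true else false.
  by case: u => i; [apply/imsetP => -[] | apply/imsetP; exists i].
move=> x y; rewrite !inB /coadj; case: x y => [i|i] [j|j] //=; rewrite ?andbF //.
by case: (eqVneq i j) => [->|_]; rewrite ?eqxx ?andbF.
Qed.

Lemma co_clique_isomorphic (G H : sgraph) (A : {set G}) (B : {set H}) :
  co_clique_on A -> co_clique_on B -> #|G| = #|H| -> #|A| = #|B| ->
  isomorphic G H.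
Proof.
move=> coA coB cGH cAB; have [f bf fB] := bij_of_card cGH cAB.
exists f; split=> // x y.
by rewrite !adj_coadj coA coB !fB (inj_eq (bij_inj bf)).
Qed.

Lemma codegree_sum_co_clique (G : sgraph) (D : {set G}) :
  co_clique_on D -> codegree_sum G = (#|D| * #|D|.-1)%N.
Proof.
move=> coD; rewrite -sum_nat_const [RHS]big_mkcond; apply: eq_bigr => x _.
case: ifP => xD; last first.
  by apply: eq_card0 => y; rewrite /in_mem /= coD xD andbF.
rewrite (cardsD1 x D) xD; apply: eq_card => y.
by rewrite !inE [LHS]coD xD eq_sym.
Qed.

(** A set of [r.+1] vertices does not fit into [D], and a vertex outside [D] is isolated in the
    complement. *)
Lemma co_clique_stable r k (G : sgraph) (D : {set G}) :
  co_clique_on D -> #|D| = r -> #|G| = (r + k + 1)%N ->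
  star_stable_graph r k G.
Proof.
move=> coD cD cG; split=> //; apply/(vertex_stable_starP cG) => S cS.
have /subsetPn[x xS xD] : ~~ (S \subset D).
  by apply: contraL (ltnSn r) => /subset_leq_card; rewrite cS cD -leqNgt.
by apply/isolated_freeP => /(_ x xS)[y _]; rewrite coD (negPf xD) andbF.
Qed.

(** For even [r] the size [r.+1] is odd, while in a matching a set without isolated vertices has
    even size. *)
Lemma matching_stable r k (G : sgraph) :
  ~~ odd r -> matching (@coadj G) -> #|G| = (r + k + 1)%N ->
  star_stable_graph r k G.
Proof.
move=> er M cG; split=> //; apply/(vertex_stable_starP cG) => S cS.
apply/negP => /(matching_isolated_free_even (@coadj_sym G) (@coadj_irr G) M).
by rewrite cS /= er.
Qed.

Lemma matching_isomorphic n (G : sgraph) :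
  (0 < n)%N -> #|G| = n -> matching (@coadj G) ->
  #|nonisolated (@coadj G)| = n./2.*2 ->
  isomorphic G (complete_minus_matching n).
Proof.
move=> n_gt0 cG M cD; apply: isomorphic_sym.
have [s [us ss cs es]] := matching_enumeration (@coadj_sym G) (@coadj_irr G) M
  (eq_leq (esym cD)).
(* For odd [n], [z] is the unmatched vertex. As the default value of [nth] it becomes the image of
   the index [n.-1]. For even [n] the default is never reached. *)
have [z zs] : exists z, odd n -> z \notin s.
  have [on|en] := boolP (odd n); last first.
    have /card_gt0P[z _] : (0 < #|G|)%N by rewrite cG.
    by exists z.
  have /subsetPn[z _ zs] : ~~ ([set: G] \subset s); last by exists z.
  apply: contraL n_gt0 => /subset_leq_card /leq_trans/(_ (card_size s)).
  by rewrite cardsT cG ss; lia.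
have iz (i : 'I_n) : ~~ (i < n./2.*2)%N ->
    [/\ nth z s i = z, z \notin s, odd n & i = n.-1 :> nat].
  move=> si; rewrite nth_default ?ss; last by rewrite leqNgt.
  by have := ltn_ord i; split=> //; [apply: zs| |]; lia.
have si (i : nat) : (i < n./2.*2)%N -> nth z s i \in s.
  by move=> ?; rewrite mem_nth ?ss.
have coz x : x \in s -> z \notin s -> coadj x z = false.
  by move=> xs zNs; apply/negP=> /(cs _ _ xs); apply/negP.
have f_inj : injective (fun i : 'I_n => nth z s i).
  move=> i j; apply: contra_eq => ij; have ij' : (i != j :> nat) by [].
  have [li|/iz[-> zNs on ei]] := boolP (i < n./2.*2)%N;
    have [lj|/iz[-> zNs' on' ej]] := boolP (j < n./2.*2)%N.
  - by rewrite nth_uniq ?ss.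
  - by apply: contraNneq zNs' => <-; apply: si.
  - by apply: contraNneq zNs => ->; apply: si.
  - by rewrite ei ej eqxx in ij'.
exists (fun i : 'I_n => nth z s i); split.
  by apply: inj_card_bij => //; rewrite cG card_ord.
move=> i j; rewrite adj_coadj (inj_eq f_inj) /adj /=.
have -> : coadj (nth z s i) (nth z s j) = (i != j) && (i./2 == j./2).
  have [li|/iz[-> zNs on ei]] := boolP (i < n./2.*2)%N;
    have [lj|/iz[-> zNs' on' ej]] := boolP (j < n./2.*2)%N.
  - exact: es.
  - by rewrite coz ?si //; apply/esym/negbTE; lia.
  - by rewrite coadj_sym coz ?si //; apply/esym/negbTE; lia.
  - rewrite coadj_irr; have -> : i = j by apply: val_inj; rewrite /= ei ej.
    by rewrite eqxx.
by case: eqVneq => [->|]; rewrite ?eqxx.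
Qed.

Lemma codegree_sum_matching (G : sgraph) :
  matching (@coadj G) -> codegree_sum G = #|nonisolated (@coadj G)|.
Proof. exact: matching_sum_deg. Qed.

(** It differs from the even number n(n-1) by twice the number of edges. *)
Lemma codegree_sum_even (G : sgraph) : ~~ odd (codegree_sum G).
Proof.
have := sum_codegree G; rewrite -/(codegree_sum G) => /(congr1 odd).
rewrite oddD mul2n odd_double /= => ->.
by case: #|G| => // n; rewrite oddM /= andNb.
Qed.

Lemma isomorphic_matching (G H : sgraph) :
  isomorphic G H -> matching (@coadj H) -> matching (@coadj G).
Proof.
move=> [f [bf fA]] /matchingP M; apply/matchingP => x y z.
have E u v : coadj u v = coadj (f u) (f v).
  by rewrite /coadj fA (inj_eq (bij_inj bf)).
by rewrite !E => xy /(M _ _ _ xy)/(bij_inj bf).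
Qed.

(** * Complements of the two extremal graphs of matching type *)

Lemma coadj_complete_minus_matching n (x y : complete_minus_matching n) :
  coadj x y = (x != y) && (x./2 == y./2).
Proof. by rewrite /coadj /adj /= negbK. Qed.

Lemma matching_complete_minus_matching n :
  matching (@coadj (complete_minus_matching n)).
Proof.
apply/matchingP => x y z; rewrite !coadj_complete_minus_matching -!val_eqE /=.
by move=> xy xz; apply: val_inj => /=; lia.
Qed.

Lemma nonisolated_complete_minus_matching n (x : complete_minus_matching n) :
  ~~ odd n -> exists y, coadj x y.
Proof.
move=> en; have xn := ltn_ord x.
(* The partner is the other index with the same half; it stays below [n] because [n] is even. *)
have yn : ((if odd x then x.-1 else x.+1) < n)%N by case: ifP; lia.
exists (Ordinal yn); rewrite coadj_complete_minus_matching -val_eqE /=.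
by case: ifP; lia.
Qed.

Lemma card_nonisolated_complete_minus_matching n : ~~ odd n ->
  #|nonisolated (@coadj (complete_minus_matching n))| = n./2.*2.
Proof.
move=> en; rewrite (_ : nonisolated _ = setT) ?cardsT ?card_ord; first by lia.
apply/setP=> x; rewrite in_setT.
exact/nonisolatedP/nonisolated_complete_minus_matching.
Qed.

Section JoinVertex.
Variable n : nat.
Let J := join (complete_minus_matching n) (complete 1).

Lemma coadj_join_vertex (x y : J) :
  coadj x y = match x, y with
              | inl i, inl j => @coadj (complete_minus_matching n) i j
              | _, _ => false
              end.
Proof.
rewrite /coadj; case: x y => [i|i] [j|j] //=; rewrite ?andbF //.
by rewrite (ord1 i) (ord1 j) eqxx.
Qed.

Lemma matching_join_vertex : matching (@coadj J).
Proof.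
apply/matchingP => -[x|x] [y|y] [z|z]; rewrite !coadj_join_vertex //.
by move=> xy /(matchingP _ (matching_complete_minus_matching n) _ _ _ xy)->.
Qed.

Lemma card_nonisolated_join_vertex : ~~ odd n ->
  #|nonisolated (@coadj J)| = n./2.*2.
Proof.
move=> en; transitivity #|[set inl x | x : complete_minus_matching n] : {set J}|.
  apply: eq_card => -[x|x].
    have [y xy] := nonisolated_complete_minus_matching x en.
    rewrite [RHS]imset_f //; apply/nonisolatedP.
    by exists (inl y); rewrite coadj_join_vertex.
  apply/nonisolatedP/imsetP => [[y]|[]//].
  by rewrite coadj_join_vertex.
by rewrite card_imset ?card_ord; [lia | apply: inl_inj].
Qed.

Lemma card_join_vertex : #|J| = (n + 1)%N.
Proof. by rewrite card_sum !card_ord. Qed.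

End JoinVertex.

(** * The dichotomy: few non-isolated vertices in the complement, or a matching *)

Lemma star_stable_classification r k (G : sgraph) : (3 <= r)%N ->
  star_stable_graph r k G ->
  (codegree_sum G <= r * r.-1 /\
     (codegree_sum G = r * r.-1 -> isomorphic G (Grk r k)))%N
  \/ [/\ ~~ odd r, codegree_sum G <= (r + k + 1)./2.*2
       & codegree_sum G = (r + k + 1)./2.*2 ->
         isomorphic G (complete_minus_matching (r + k + 1))]%N.
Proof.
move=> r3 [+ cG] => /(vertex_stable_starP cG) stable.
have [Dr|rD] := leqP #|nonisolated (@coadj G)| r.
  left; have [le eq] := sum_deg_leqif (@coadj_sym G) (@coadj_irr G).
  rewrite /codegree_sum; split=> [|E]; first by nia.
  (* With d non-isolated vertices, r(r-1) <= d(d-1) and d <= r force d = r. *)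
  have cD : #|nonisolated (@coadj G)| = r by nia.
  move: eq; rewrite E cD eqxx => /esym/forall_inP full.
  apply: (co_clique_isomorphic (A := nonisolated (@coadj G)) _
    (@co_clique_Grk r k)); last 2 first.
  - by rewrite cG card_Grk.
  - by rewrite cD card_right_part card_ord.
  move=> x y; apply/idP/and3P => [xy|[xy xD yD]].
    split; [by case/andP: xy | by apply/nonisolatedP; exists y |].
    by apply/nonisolatedP; exists x; rewrite coadj_sym.
  by apply: (subsetP (full x xD)); rewrite in_setD1 eq_sym xy.
(* If the complement is not a matching, it has [r.+1] vertices inducing no isolated vertex, against
   stability. *)
right; have [M|nM] := boolP (matching (@coadj G)); last first.
  have [|S cS fS] := exists_isolated_free (@coadj_sym G) (@coadj_irr G)
    (s := r.+1) nM; first by lia.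
  by have := stable S cS; rewrite fS.
(* For odd [r], (r+1)/2 pairs of the matching would form a forbidden set of [r.+1] vertices. *)
have even_r : ~~ odd r.
  apply/negP => odd_r; have [|s [us ss cs es]] := matching_enumeration
    (@coadj_sym G) (@coadj_irr G) (j := r.+1./2) M; first by lia.
  have [x xD] : exists x : G, x \in nonisolated (@coadj G).
    by apply/card_gt0P; lia.
  have cS : #|[set y in s]| = r.+1 by rewrite cardsE (card_uniqP us) ss; lia.
  apply: negP (stable _ cS) _; apply/isolated_freeP => y; rewrite inE => ys.
  have iy : (index y s < r.+1./2.*2)%N by rewrite -ss index_mem.
  pose i := index y s; pose i' := if odd i then i.-1 else i.+1.
  have li' : (i' < r.+1./2.*2)%N by rewrite /i' /i; case: ifP; lia.
  exists (nth x s i'); first by rewrite inE mem_nth ?ss.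
  by rewrite -{1}(nth_index x ys) es // /i'; case: ifP; rewrite /i; lia.
have cM := codegree_sum_matching M.
have := max_card (nonisolated (@coadj G)); rewrite cG -cM => le.
(* Evenness sharpens the bound r+k+1 to the largest even number not above it. *)
have ev := codegree_sum_even G.
split=> // [|E]; first by lia.
by apply: matching_isomorphic => //; [lia | rewrite -cM].
Qed.

(** * From complement degree sums to rational edge bounds *)

Section Bounds.
Variables (r k a M : nat) (b : rat).
Hypotheses (aM : (a + M = (r + k + 1) * (r + k))%N) (ab : b = (1 / 2 * a%:R)%R).

Let edges_codegree G : star_stable_graph r k G ->
  (2 * #|edges G| + codegree_sum G = a + M)%N.
Proof. by case=> _ cG; rewrite aM sum_codegree cG addn1. Qed.

(** Here [a] is twice the edge bound and [M] the bound on the complement degree sum. They add up to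
    n(n-1) for n = r+k+1, so bounding one quantity from above bounds the other from below. *)
Lemma edge_lower_bound_codegree :
  (forall G, star_stable_graph r k G -> (codegree_sum G <= M)%N) ->
  edge_lower_bound r k b.
Proof.
move=> H G sG; have := H G sG; have := edges_codegree sG => E le.
have : (a%:R <= (2 * #|edges G|)%:R :> rat)%R by rewrite ler_nat; lia.
by rewrite ab natrM; lra.
Qed.

Lemma extremal_codegree G :
  extremal r k b G <-> star_stable_graph r k G /\ codegree_sum G = M.
Proof.
split=> -[sG E]; split=> //; have := edges_codegree sG => H.
  have /eqP : (a%:R = (2 * #|edges G|)%:R :> rat)%R by rewrite natrM E ab; lra.
  by rewrite eqr_nat => /eqP; lia.
have : (a%:R = (2 * #|edges G|)%:R :> rat)%R by congr (_%:R)%R; lia.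
by rewrite ab natrM; lra.
Qed.

End Bounds.

(** * Graphs attaining the bounds *)

Lemma Grk_extremal r k :
  star_stable_graph r k (Grk r k) /\ codegree_sum (Grk r k) = (r * r.-1)%N.
Proof.
have cB : #|right_part (complete k.+1) (edgeless r)| = r.
  by rewrite card_right_part card_ord.
split; first exact: co_clique_stable (@co_clique_Grk r k) cB (card_Grk _ _).
by rewrite (codegree_sum_co_clique (@co_clique_Grk r k)) cB.
Qed.

Lemma complete_minus_matching_extremal r k : ~~ odd r -> odd k ->
  star_stable_graph r k (complete_minus_matching (r + k + 1)) /\
  codegree_sum (complete_minus_matching (r + k + 1)) = (r + k + 1)./2.*2.
Proof.
move=> er ok; have M := matching_complete_minus_matching (r + k + 1).
split; first by apply: matching_stable; rewrite ?card_ord.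
rewrite codegree_sum_matching // card_nonisolated_complete_minus_matching //.
by lia.
Qed.

Lemma join_vertex_extremal r k : ~~ odd r -> ~~ odd k ->
  let J := join (complete_minus_matching (r + k)) (complete 1) in
  star_stable_graph r k J /\ codegree_sum J = (r + k + 1)./2.*2.
Proof.
move=> er ek J; have M := matching_join_vertex (r + k).
split; first by apply: matching_stable; rewrite ?card_join_vertex.
by rewrite codegree_sum_matching // card_nonisolated_join_vertex; lia.
Qed.

(** For even [n] both complements are matchings leaving out one of the n+1 vertices. This turns the
    graph of the classification into the join named in the theorem. *)
Lemma join_vertex_isomorphic n : ~~ odd n ->
  isomorphic (complete_minus_matching (n + 1))
    (join (complete_minus_matching n) (complete 1)).
Proof.
move=> en; apply/isomorphic_sym/matching_isomorphic; first by lia.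
- exact: card_join_vertex.
- exact: matching_join_vertex.
- by rewrite card_nonisolated_join_vertex; lia.
Qed.

(** Three independent vertices form a triangle in the complement, which no matching contains. This
    separates the two extremal graphs in the tie cases. *)
Lemma Grk_not_matching r k (G : sgraph) : (3 <= r)%N ->
  matching (@coadj G) -> ~ isomorphic (Grk r k) G.
Proof.
case: r => [|[|[|r]]] // _ M /isomorphic_matching/(_ M)/matchingP MG.
pose v (i : 'I_3) : Grk r.+3 k := inr (widen_ord (isT : 3 <= r.+3)%N i).
have vP (i j : 'I_3) : i != j -> coadj (v i) (v j).
  by move=> ij; rewrite /coadj andbT; apply: contra_neq ij => -[] /val_inj.
pose o m lm : 'I_3 := @Ordinal 3 m lm.
pose v0 := o 0 isT; pose v1 := o 1 isT; pose v2 := o 2 isT.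
by have /eqP := MG _ _ _ (vP v0 v1 isT) (vP v0 v2 isT).
Qed.

(** * Comparison of r(r-1) with the matching bound, case by case *)

Local Open Scope ring_scope.

Theorem theorem1 (r k : nat) (r_ge3 : (3 <= r)%N) :
  [/\ (odd r \/ ~~ odd r /\ (k < (r - 1) ^ 2 - 2)%N ->
         let b : rat := 1 / 2 * ((k%:R + 1) * (2 * r%:R + k%:R)) in
         edge_lower_bound r k b /\ sole (extremal r k b) (Grk r k)),
      (~~ odd r /\ k = ((r - 1) ^ 2 - 2)%N ->
         let b : rat := 1 / 2 * ((k%:R + 1) * (2 * r%:R + k%:R)) in
         edge_lower_bound r k b /\
         exactly_two (extremal r k b)
           (Grk r k) (complete_minus_matching (r + k + 1)))
      /\
      (~~ odd r /\ k = ((r - 1) ^ 2 - 1)%N ->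
         let b : rat := 1 / 2 * ((k%:R + 1) * (2 * r%:R + k%:R)) in
         edge_lower_bound r k b /\
         exactly_two (extremal r k b)
           (Grk r k) (join (complete_minus_matching (r + k)) (complete 1))),
      ([/\ ~~ odd r, odd k & (k0 r <= k)%N] ->
         let b : rat := 1 / 2 * ((r%:R + k%:R) ^+ 2 - 1) in
         edge_lower_bound r k b /\
         sole (extremal r k b) (complete_minus_matching (r + k + 1)))
    & ([/\ ~~ odd r, ~~ odd k & (k0 r <= k)%N] ->
         let b : rat := 1 / 2 * (r%:R + k%:R) ^+ 2 in
         edge_lower_bound r k b /\
         sole (extremal r k b)
           (join (complete_minus_matching (r + k)) (complete 1)))].
Proof.
have cls G := @star_stable_classification r k G r_ge3.
have [sK cK] := Grk_extremal r k.
have sq : ((r - 1) ^ 2 = r * r.-1 - r.-1)%N by rewrite -mulnn; nia.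
have r_sq : (2 * r <= r * r.-1)%N by nia.
have aK : ((k + 1) * (2 * r + k) + r * r.-1 = (r + k + 1) * (r + k))%N.
  by case: r r_ge3 {cls sK cK sq r_sq} => // r' _ /=; nia.
have bK : (1 / 2 * ((k%:R + 1) * (2 * r%:R + k%:R)) =
           1 / 2 * ((k + 1) * (2 * r + k))%N%:R :> rat)%R.
  by rewrite natrM (natrD _ k) (natrD _ (2 * r)) natrM.
(* This fixes the parity of [k] in the two tie cases. *)
have even_sq : ~~ odd r -> odd ((r - 1) ^ 2) by move=> er; rewrite oddX; lia.
(* For even [r], (r-1)^2-1 is even, so an odd number above (r-1)^2-2 is at least (r-1)^2. *)
have k0_ge : (k0 r <= k)%N -> ~~ odd r -> ((r - 1) ^ 2 <= k)%N.
  rewrite /k0; case: ex_minnP => m /andP[lm om] _ mk /even_sq.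
  by lia.
split; [|split|..].
(* The matching alternative needs even [r], and then k < (r-1)^2-2 makes its bound r+k+1 smaller
   than r(r-1). *)
- move=> small b; split.
    apply: edge_lower_bound_codegree aK bK _ => G /cls[[]//|[er le _]].
    by case: small => [|[_]]; [rewrite (negPf er) | lia].
  split; first by apply/(extremal_codegree aK bK).
  move=> G /(extremal_codegree aK bK)[/cls[[_ iso]|[er le _]] E].
    exact: iso.
  by case: small => [|[_]]; [rewrite (negPf er) | lia].
- move=> [er Ek] b; have ok : odd k by have := even_sq er; lia.
  have [sM cM] := complete_minus_matching_extremal er ok.
  (* The tie: r+k+1 is exactly r(r-1), which is even. *)
  have EM : ((r + k + 1)./2.*2 = r * r.-1)%N by lia.
  rewrite EM in cM; split.
    by apply: edge_lower_bound_codegree aK bK _ => G /cls[[]//|[_]]; rewrite EM.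
  split; try by apply/(extremal_codegree aK bK).
    exact/Grk_not_matching/matching_complete_minus_matching.
  by move=> G /(extremal_codegree aK bK)[/cls[[_ iso] E|[_ _]]];
    [left; apply: iso | rewrite EM => iso E; right; apply: iso].
- move=> [er Ek] b; have ek : ~~ odd k by have := even_sq er; lia.
  have [sM cM] := join_vertex_extremal er ek.
  (* Here r+k+1 = r(r-1)+1 is odd, and rounding down to an even number gives the tie again. *)
  have EM : ((r + k + 1)./2.*2 = r * r.-1)%N by lia.
  rewrite EM in cM; split.
    by apply: edge_lower_bound_codegree aK bK _ => G /cls[[]//|[_]]; rewrite EM.
  split; try by apply/(extremal_codegree aK bK).
    exact/Grk_not_matching/matching_join_vertex.
  move=> G /(extremal_codegree aK bK)[/cls[[_ iso] E|[_ _]]].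
    by left; apply: iso.
  rewrite EM => iso E; right; apply: isomorphic_trans (iso E) _.
  by apply: join_vertex_isomorphic; lia.
- move=> [er ok /k0_ge/(_ er) lk] b.
  have [sM cM] := complete_minus_matching_extremal er ok.
  (* From k >= (r-1)^2 one gets r+k+1 >= r(r-1)+2, so the matching wins strictly. *)
  have EM : (r * r.-1 < (r + k + 1)./2.*2)%N by lia.
  (* With n = r+k+1 even, n(n-1) - n = (n-1)^2 - 1. *)
  have aM : ((r + k) ^ 2 - 1 + (r + k + 1)./2.*2 = (r + k + 1) * (r + k))%N.
    have -> : ((r + k + 1)./2.*2 = r + k + 1)%N by lia.
    have : (0 < (r + k) ^ 2)%N by rewrite expn_gt0; lia.
    by rewrite mulnDl mul1n mulnn; case: ((r + k) ^ 2)%N => // q _; clear; lia.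
  have bM : (b = 1 / 2 * ((r + k) ^ 2 - 1)%N%:R)%R.
    by rewrite natrB ?natrX ?natrD // expn_gt0; lia.
  split.
    by apply: edge_lower_bound_codegree aM bM _ => G /cls[[le _]|[_]//]; lia.
  split; first by apply/(extremal_codegree aM bM).
  move=> G /(extremal_codegree aM bM)[/cls[[le _] E|[_ _ iso] //]]; lia.
- move=> [er ek /k0_ge/(_ er) lk] b.
  have [sM cM] := join_vertex_extremal er ek.
  have EM : (r * r.-1 < (r + k + 1)./2.*2)%N by lia.
  (* With n = r+k+1 odd, the matching misses one vertex, and n(n-1) - (n-1) = (n-1)^2. *)
  have aM : ((r + k) ^ 2 + (r + k + 1)./2.*2 = (r + k + 1) * (r + k))%N.
    have -> : ((r + k + 1)./2.*2 = r + k)%N by lia.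
    by rewrite mulnDl mul1n mulnn.
  have bM : (b = 1 / 2 * ((r + k) ^ 2)%N%:R)%R by rewrite natrX natrD.
  split.
    by apply: edge_lower_bound_codegree aM bM _ => G /cls[[le _]|[_]//]; lia.
  split; first by apply/(extremal_codegree aM bM).
  move=> G /(extremal_codegree aM bM)[/cls[[le _] E|[_ _ iso] E]]; first by lia.
  apply: isomorphic_trans (iso E) _.
  by apply: join_vertex_isomorphic; lia.
Qed.
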